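(* Let $p$ be a prime, $q$ a power of $p$, $l$ a prime different from $p$, and let $\theta\colon \mathbb{F}_q\to\overline{\mathbb{Q}}_l^{\times}$ be a non-trivial additive character. Let $V\subset\mathbb{P}^3_{\mathbb{F}_q}=\operatorname{Proj}\mathbb{F}_q[x_1,x_2,x_3,x_4]$ be the closed subscheme (the image of the triple embedding $\mathbb{P}^1\hookrightarrow\mathbb{P}^3$) defined by the three homogeneous polynomials \[ f_1=x_1x_3-x_2^2,\quad f_2=x_2x_4-x_3^2,\quad f_3=x_1x_4-x_2x_3. \] Let \[ L=\sum_{t_1,t_2,t_3\in\mathbb{F}_q^{\times}}\theta\left(t_1+t_2+t_3-t_1^2t_2^{-2}t_3-t_1^2t_2^{-3}t_3^2-t_1t_2^{-2}t_3^2\right). \] Then the number of $\mathbb{F}_q$-rational points of $V$ satisfies \[ \#V(\mathbb{F}_q)=-2q^2+6q-1+\frac{(q-1)L-1}{q}. \]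
   Context: $\overline{\mathbb{Q}}_l$ denotes an algebraic closure of the $l$-adic numbers. An additive character is a group homomorphism $(\mathbb{F}_q,+)\to\overline{\mathbb{Q}}_l^{\times}$; non-trivial means not identically $1$. *)

(* Defs.v *)
From HB Require Import structures.
From mathcomp Require Import all_boot all_order all_algebra.
From mathcomp Require Import fraction.
From mathcomp Require Import boolp.
From mathcomp Require Import mpoly.

Set Implicit Arguments.
Unset Strict Implicit.
Unset Printing Implicit Defensive.

Import Order.TTheory GRing.Theory Num.Theory.

Local Open Scope ring_scope.

(* The l-adic integers, as the inverse limit of the rings Z/l^n: the n-th       *)
(* component is the representative in [0, l^n) of the residue modulo l^n (the   *)
(* compatibility condition also forces each component to be reduced). The       *)
(* primality proof is a parameter of the type so that it can be given the       *)
(* structure of an integral domain.                                             *)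
Record padic_int (l : nat) (l_prime : prime l) := PadicInt {
  padic_res :> nat -> int;
  padic_resP : forall n, (padic_res n.+1 %% (l ^ n)%:Z)%Z = padic_res n
}.

Section PadicInt.
Variables (l : nat) (l_prime : prime l).
Local Notation Zl := (padic_int l_prime).
Local Notation lX n := ((l ^ n)%N%:Z).

HB.instance Definition _ := gen_eqMixin Zl.
HB.instance Definition _ := gen_choiceMixin Zl.

Lemma padic_int_eq (a b : Zl) : (forall n, a n = b n) -> a = b.
Proof.
case: a b => [a aP] [b bP] /= /funext eq_ab.
by rewrite -{}eq_ab in bP *; congr PadicInt; apply: Prop_irrelevance.
Qed.

Lemma padic_res_mod (a : Zl) n : (a n %% lX n)%Z = a n.
Proof. by rewrite -(padic_resP a n) modz_mod. Qed.

Lemma padic_res_ltn (a : Zl) n m : (a (n + m)%N = a n %[mod lX n])%Z.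
Proof.
elim: m => [|m IHm]; first by rewrite addn0.
rewrite addnS -IHm -(padic_resP a (n + m)).
set x := a _; apply/eqP; rewrite eqz_mod_dvd.
have -> : x - (x %% lX (n + m))%Z = (x %/ lX (n + m))%Z * lX (n + m).
  by rewrite {1}(divz_eq x (lX (n + m))) addrK.
by apply: dvdz_mull; rewrite dvdzE /= dvdn_exp2l // leq_addr.
Qed.

Lemma padic_of_subproof (s : nat -> int) :
    (forall n, s n.+1 = s n %[mod lX n])%Z ->
  forall n, ((s n.+1 %% lX n.+1)%Z %% lX n)%Z = (s n %% lX n)%Z.
Proof.
move=> sP n; rewrite -(sP n); apply/eqP; rewrite eqz_mod_dvd.
rewrite {2}(divz_eq (s n.+1) (lX n.+1)) opprD addrCA subrr addr0 rpredN.
by apply: dvdz_mull; rewrite dvdzE /= dvdn_exp2l.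
Qed.

Definition padic_of (s : nat -> int) sP : Zl :=
  PadicInt l_prime (@padic_of_subproof s sP).

Lemma padic_const_subproof (c : int) n : (c = c %[mod lX n])%Z.
Proof. by []. Qed.

Lemma padic_add_subproof (a b : Zl) n :
  (a n.+1 + b n.+1 = a n + b n %[mod lX n])%Z.
Proof. by rewrite -modzDm !padic_resP. Qed.

Lemma padic_opp_subproof (a : Zl) n : (- a n.+1 = - a n %[mod lX n])%Z.
Proof. by rewrite -modzNm padic_resP. Qed.

Lemma padic_mul_subproof (a b : Zl) n :
  (a n.+1 * b n.+1 = a n * b n %[mod lX n])%Z.
Proof. by rewrite -modzMm !padic_resP. Qed.

Definition padic_zero : Zl := padic_of (padic_const_subproof 0).
Definition padic_one : Zl := padic_of (padic_const_subproof 1).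
Definition padic_add (a b : Zl) : Zl := padic_of (padic_add_subproof a b).
Definition padic_opp (a : Zl) : Zl := padic_of (padic_opp_subproof a).
Definition padic_mul (a b : Zl) : Zl := padic_of (padic_mul_subproof a b).

Lemma padic_addA : associative padic_add.
Proof.
by move=> a b c; apply: padic_int_eq => n /=; rewrite modzDml modzDmr addrA.
Qed.

Lemma padic_addC : commutative padic_add.
Proof. by move=> a b; apply: padic_int_eq => n /=; rewrite addrC. Qed.

Lemma padic_add0 : left_id padic_zero padic_add.
Proof.
by move=> a; apply: padic_int_eq => n /=; rewrite modzDml add0r padic_res_mod.
Qed.

Lemma padic_addN : left_inverse padic_zero padic_opp padic_add.
Proof. by move=> a; apply: padic_int_eq => n /=; rewrite modzDml addNr. Qed.

HB.instance Definition _ :=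
  GRing.isZmodule.Build Zl padic_addA padic_addC padic_add0 padic_addN.

Lemma padic_mulA : associative padic_mul.
Proof.
by move=> a b c; apply: padic_int_eq => n /=; rewrite modzMml modzMmr mulrA.
Qed.

Lemma padic_mulC : commutative padic_mul.
Proof. by move=> a b; apply: padic_int_eq => n /=; rewrite mulrC. Qed.

Lemma padic_mul1 : left_id padic_one padic_mul.
Proof.
by move=> a; apply: padic_int_eq => n /=; rewrite modzMml mul1r padic_res_mod.
Qed.

Lemma padic_mulD : left_distributive padic_mul padic_add.
Proof.
move=> a b c; apply: padic_int_eq => n /=.
by rewrite modzMml modzDml modzDmr mulrDl.
Qed.

Lemma padic_one_neq0 : padic_one != padic_zero.
Proof.
apply/eqP => /(congr1 (fun a : Zl => a 1%N)) /= /eqP.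
rewrite eqz_mod_dvd subr0 expn1 dvdzE /= dvdn1 => /eqP l1.
by move: l_prime; rewrite l1.
Qed.

HB.instance Definition _ := GRing.Zmodule_isComNzRing.Build Zl
  padic_mulA padic_mulC padic_mul1 padic_mulD padic_one_neq0.

Definition padic_unit : {pred Zl} := fun a => `[< exists b : Zl, b * a = 1 >].

Definition padic_inv (a : Zl) : Zl :=
  if pselect (exists b : Zl, b * a = 1) is left ab then projT1 (cid ab) else a.

Lemma padic_mulV : {in padic_unit, left_inverse 1 padic_inv *%R}.
Proof.
move=> a /asboolP ua; rewrite /padic_inv.
by case: pselect => // ab; apply: (projT2 (cid ab)).
Qed.

Lemma padic_unitP (a b : Zl) : b * a = 1 -> padic_unit a.
Proof. by move=> ba; apply/asboolP; exists b. Qed.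

Lemma padic_inv_out : {in [predC padic_unit], padic_inv =1 id}.
Proof.
move=> a /negP ua; rewrite /padic_inv; case: pselect => // ab.
by case: ua; apply/asboolP.
Qed.

HB.instance Definition _ := GRing.ComNzRing_hasMulInverse.Build Zl
  padic_mulV padic_unitP padic_inv_out.

Lemma padic_neq0 (a : Zl) : a != 0 -> exists n, ~~ (lX n %| a n)%Z.
Proof.
move=> a_neq0; apply: contrapT => /forallNP a_eq0; case/eqP: a_neq0.
apply: padic_int_eq => n /=; rewrite mod0z -padic_res_mod.
by apply/dvdz_mod0P; apply: contrapT => /negP; apply: a_eq0.
Qed.

Lemma padic_mulf_eq0 : GRing.integral_domain_axiom Zl.
Proof.
move=> a b ab0; apply/norP => -[/padic_neq0[i ai] /padic_neq0[j bj]].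
have {}ai : ~~ (lX i %| a (i + j)%N)%Z.
  by apply: contra ai => /dvdz_mod0P; rewrite padic_res_ltn => /dvdz_mod0P.
have {}bj : ~~ (lX j %| b (i + j)%N)%Z.
  apply: contra bj => /dvdz_mod0P.
  by rewrite addnC padic_res_ltn => /dvdz_mod0P.
have /dvdz_mod0P : ((a (i + j)%N * b (i + j)%N) %% lX (i + j))%Z = 0.
  by have /= := congr1 (fun c : Zl => c (i + j)%N) ab0; rewrite mod0z.
move: ai bj; rewrite !dvdzE /= abszM.
set x := absz (a _); set y := absz (b _).
have [->|x_gt0] := posnP x; first by rewrite dvdn0.
have [->|y_gt0] := posnP y; first by rewrite dvdn0.
rewrite !pfactor_dvdn ?muln_gt0 ?x_gt0 // lognM // -!ltnNge => xi yj.
by rewrite leqNgt -addSn; rewrite (leq_add xi (ltnW yj)).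
Qed.

HB.instance Definition _ :=
  GRing.ComUnitRing_isIntegral.Build Zl padic_mulf_eq0.

End PadicInt.

Definition padic (l : nat) (l_prime : prime l) : fieldType :=
  {fraction padic_int l_prime}.

(* E is algebraically closed by its type, so only algebraicity remains to be   *)
(* required.                                                                    *)
Definition is_algebraic_closure (F : fieldType) (E : closedFieldType)
    (iota : {rmorphism F -> E}) : Prop :=
  forall x : E, algebraicOver iota x.

(* Non-vanishing makes theta a map into the multiplicative group of E.          *)
Definition additive_character (F : zmodType) (E : fieldType) (theta : F -> E) :=
  (forall x, theta x != 0) /\ {morph theta : x y / x + y >-> x * y}.

Definition nontrivial_character (F : zmodType) (E : fieldType) (theta : F -> E) :=
  ~ (forall x, theta x = 1).

Section ProjectiveSpace.
Variables (F : finFieldType) (n : nat).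

(* The point [v_0 : ... : v_n], as the class of all its homogeneous coordinates *)
(* (for v != 0).                                                                *)
Definition proj_point (v : 'rV[F]_n.+1) : {set 'rV[F]_n.+1} :=
  [set c *: v | c : F & c != 0].

Definition proj_space : {set {set 'rV[F]_n.+1}} :=
  [set proj_point v | v : 'rV[F]_n.+1 & v != 0].

(* F-rational points of the closed subscheme of the projective n-space over F   *)
(* defined by the homogeneous polynomials fs.                                   *)
Definition proj_zeros (fs : seq {mpoly F[n.+1]}) : {set {set 'rV[F]_n.+1}} :=
  [set P in proj_space | [forall v in P, all (fun f => f.@[v ord0] == 0) fs]].

End ProjectiveSpace.

Section TwistedCubic.
Variable F : finFieldType.

Definition x1 : {mpoly F[4]} := 'X_(inord 0).
Definition x2 : {mpoly F[4]} := 'X_(inord 1).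
Definition x3 : {mpoly F[4]} := 'X_(inord 2).
Definition x4 : {mpoly F[4]} := 'X_(inord 3).

Definition f1 := x1 * x3 - x2 ^+ 2.
Definition f2 := x2 * x4 - x3 ^+ 2.
Definition f3 := x1 * x4 - x2 * x3.

Lemma cubic_homog : all (fun f => f \is 2.-homog) [:: f1; f2; f3].
Proof.
have hX i : ('X_i : {mpoly F[4]}) \is 1.-homog by rewrite dhomogX /= mdeg1.
by apply/and4P; split=> //; rewrite rpredB // ?expr2 (dhomogM (hX _) (hX _)).
Qed.

Definition twisted_cubic : {set {set 'rV[F]_4}} :=
  proj_zeros [:: f1; f2; f3].

Definition exp_sum (E : fieldType) (theta : F -> E) : E :=
  \sum_(t1 : F | t1 != 0) \sum_(t2 : F | t2 != 0) \sum_(t3 : F | t3 != 0)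
    theta (t1 + t2 + t3 - t1 ^+ 2 * t2 ^- 2 * t3
           - t1 ^+ 2 * t2 ^- 3 * t3 ^+ 2 - t1 * t2 ^- 2 * t3 ^+ 2).

End TwistedCubic.

(* Main.v *)
(** Substituting t1 = a t2 and t3 = b t2 makes the phase of the exponential sum
    linear in t2, with slope 1 + a + b - ab(a + b + ab), which factors as
    (1 - ab)(1 + a)(1 + b). Orthogonality of characters therefore gives
    L = q N - (q - 1)^2, where N counts the pairs of non-zero a, b on the three
    curves ab = 1, a = -1, b = -1. Any two of these meet exactly in (-1, -1),
    so N = 3(q - 1) - 2. On the other side V is a projective line, with q + 1
    points, and the formula is an identity between polynomials in q. *)
Require Import Defs.
From HB Require Import structures.
From mathcomp Require Import all_boot all_order all_algebra.
From mathcomp Require Import finfield mpoly ring.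
Import GRing.Theory.
Local Open Scope ring_scope.

Section Points.
Variable F : finFieldType.

Lemma proj_pointP (n : nat) (v w : 'rV[F]_n.+1) :
  reflect (exists2 c, c != 0 & w = c *: v) (w \in proj_point v).
Proof.
by apply: (iffP imsetP) => -[c c0 ->]; exists c => //; move: c0; rewrite inE.
Qed.

Lemma proj_point_id (n : nat) (v : 'rV[F]_n.+1) : v \in proj_point v.
Proof. by apply/proj_pointP; exists 1; rewrite ?oner_eq0 ?scale1r. Qed.

Lemma proj_pointZ (n : nat) (c : F) (v : 'rV[F]_n.+1) :
  c != 0 -> proj_point (c *: v) = proj_point v.
Proof.
move=> c0; apply/setP=> w; apply/proj_pointP/proj_pointP => -[d d0 ->].
  by exists (d * c); rewrite ?scalerA // mulf_neq0.
by exists (d / c); rewrite ?scalerA ?divfK // mulf_neq0 ?invr_eq0.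
Qed.

(* [Some t] and [None] stand for the points [1 : t] and [0 : 1] of the
   projective line. *)
Definition veronese (o : option F) : 'rV[F]_4 :=
  \row_(j < 4) if o is Some t then t ^+ j else (j == 3 :> nat)%:R.

Lemma veronese_neq0 (o : option F) : veronese o != 0.
Proof.
case: o => [t|]; apply/eqP/rowP => H.
  by have /eqP := H (inord 0); rewrite !mxE inordK // expr0 oner_eq0.
by have /eqP := H (inord 3); rewrite !mxE inordK // oner_eq0.
Qed.

Lemma cubic_equationsP (v : 'rV[F]_4) :
  let x i := v 0 (inord i) in
  reflect [/\ x 0%N * x 2%N = x 1%N ^+ 2, x 1%N * x 3%N = x 2%N ^+ 2
            & x 0%N * x 3%N = x 1%N * x 2%N]
          (all (fun f => f.@[v ord0] == 0) [:: f1 F; f2 F; f3 F]).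
Proof.
move=> x; rewrite /= andbT !mevalB !expr2 !mevalM !mevalXU !subr_eq0.
by apply: (iffP and3P) => -[/eqP ? /eqP ? /eqP ?]; split=> //; apply/eqP.
Qed.

Lemma row4P (v w : 'rV[F]_4) :
  v 0 (inord 0) = w 0 (inord 0) -> v 0 (inord 1) = w 0 (inord 1) ->
  v 0 (inord 2) = w 0 (inord 2) -> v 0 (inord 3) = w 0 (inord 3) -> v = w.
Proof.
move=> h0 h1 h2 h3; apply/rowP => j; rewrite -(inord_val j).
by case: j => -[|[|[|[|]]]].
Qed.

(** Stated for all multiples because [proj_zeros] tests every representative of a point. *)
Lemma veronese_cone (o : option F) (c : F) :
  all (fun f => f.@[(c *: veronese o) ord0] == 0) [:: f1 F; f2 F; f3 F].
Proof.
apply/cubic_equationsP; rewrite !mxE !inordK //.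
by case: o => [t|] /=; split; rewrite ?mulr0n; ring.
Qed.

(** If the first coordinate vanishes, the equations successively kill the next two, leaving the
    point at infinity. Otherwise x1 / x0 is the parameter and the equations determine x2 and x3. *)
Lemma cubic_cone_veronese (v : 'rV[F]_4) :
    v != 0 -> all (fun f => f.@[v ord0] == 0) [:: f1 F; f2 F; f3 F] ->
  exists o, v \in proj_point (veronese o).
Proof.
move=> v0 /cubic_equationsP [].
(* The names follow the order in which the coordinates first occur in the equations. *)
set x0 := v _ _; set x2 := v _ _; set x1 := v _ _; set x3 := v _ _.
move=> e1 e2 e3.
have [x00|x00] := eqVneq x0 0.
  have x10 : x1 = 0 by apply/eqP; rewrite -sqrf_eq0 -e1 x00 mul0r.
  have x20 : x2 = 0 by apply/eqP; rewrite -sqrf_eq0 -e2 x10 mul0r.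
  exists None; apply/proj_pointP; exists x3.
    apply: contraNneq v0 => x30; apply/eqP.
    by apply: row4P; rewrite mxE.
  by apply: row4P; rewrite !mxE !inordK //= ?mulr0 ?mulr1.
exists (Some (x1 / x0)); apply/proj_pointP; exists x0 => //.
have e2' : x2 = x1 ^+ 2 / x0 by rewrite -e1; field.
have e3' : x3 = x1 * x2 / x0 by rewrite -e3; field.
apply: row4P; rewrite !mxE !inordK //=.
- by rewrite expr0 mulr1.
- by rewrite -/x1; field.
- by rewrite -/x2 e2'; field.
- by rewrite -/x3 e3' e2'; field.
Qed.

(** The first two coordinates suffice: the first separates infinity from the affine points and
    forces the scalar to be 1 on the latter, and the second is then the parameter. *)
Lemma proj_point_veronese_inj :
  injective (fun o => proj_point (veronese o)).
Proof.
move=> o o' eq_oo'; have := proj_point_id _ (veronese o).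
rewrite eq_oo' => /proj_pointP [c c0 /rowP H].
have := H (inord 0); have := H (inord 1); rewrite !mxE !inordK //.
case: o o' {eq_oo' H} => [t|] [t'|] //=; rewrite ?expr0 ?expr1 ?mulr1 ?mulr0.
- by move=> -> <-; rewrite mul1r.
- by move=> _ /eqP; rewrite oner_eq0.
- by move=> _ /esym/eqP; rewrite (negPf c0).
Qed.

Lemma twisted_cubicE :
  twisted_cubic F = [set proj_point (veronese o) | o : option F].
Proof.
apply/setP => P; rewrite inE; apply/andP/imsetP.
  move=> [/imsetP[v v0 ->] /forall_inP H].
  rewrite inE in v0.
  have [o /proj_pointP[c c0 ->]] :=
    cubic_cone_veronese _ v0 (H _ (proj_point_id _ v)).
  by exists o; rewrite ?inE // proj_pointZ.
move=> [o _ ->]; split.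
  by apply/imsetP; exists (veronese o); rewrite ?inE ?veronese_neq0.
apply/forall_inP => w /proj_pointP[c _ ->]; exact: veronese_cone.
Qed.

Lemma card_twisted_cubic : #|twisted_cubic F| = #|F|.+1.
Proof.
rewrite twisted_cubicE card_imset ?card_option //.
exact: proj_point_veronese_inj.
Qed.

End Points.

Section Characters.
Variables (F : finFieldType) (E : fieldType) (theta : F -> E).
Hypothesis theta_char : additive_character theta.
Hypothesis theta_nontrivial : nontrivial_character theta.

Lemma character0 : theta 0 = 1.
Proof.
have [nz morph] := theta_char; apply: (mulfI (nz 0)).
by rewrite -morph addr0 mulr1.
Qed.

Lemma characterMn (x : F) (n : nat) : theta (x *+ n) = theta x ^+ n.
Proof.
elim: n => [|n IHn]; first exact: character0.
by rewrite mulrS exprS theta_char.2 IHn.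
Qed.

Lemma character_neq1 : exists x, theta x != 1.
Proof.
apply/existsP; rewrite -negb_forall; apply/forallP => H.
by apply: theta_nontrivial => x; apply/eqP.
Qed.

(** Translating by some y with [theta y] different from 1 preserves the sum, yet multiplies it by
    [theta y]. *)
Lemma sum_character : \sum_x theta x = 0.
Proof.
have [y y1] := character_neq1; apply/eqP.
have : (theta y - 1) * \sum_x theta x == 0.
  rewrite mulrBl mul1r subr_eq0 mulr_sumr [X in _ == X](reindex_inj (addrI y)).
  by apply/eqP/eq_bigr => x _; rewrite theta_char.2.
by rewrite mulf_eq0 subr_eq0 (negPf y1).
Qed.

(** Orthogonality over the whole field; the -1 removes the term t = 0. *)
Lemma sum_character_units (c : F) :
  \sum_(t | t != 0) theta (t * c) = (c == 0)%:R * #|F|%:R - 1.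
Proof.
have -> : \sum_(t | t != 0) theta (t * c) = \sum_t theta (t * c) - 1.
  by rewrite [X in _ = X - 1](bigD1 0) //= mul0r character0 [1 + _]addrC addrK.
congr (_ - 1); have [->|c0] := eqVneq c 0.
  by under eq_bigr do rewrite mulr0 character0; rewrite mul1r sumr_const.
by rewrite mul0r -[RHS]sum_character [RHS](reindex_inj (mulIf c0)).
Qed.

(* In characteristic p the p-th root of unity theta x would equal 1. *)
Lemma character_card_neq0 (p n : nat) :
  prime p -> #|F| = (p ^ n)%N -> #|F|%:R != 0 :> E.
Proof.
move=> p_pr cardF; have pF := card_finPcharP cardF p_pr.
have [x x1] := character_neq1; apply: contraNneq x1 => cardF0.
have pE : p \in [pchar E].
  rewrite inE p_pr /=; move: cardF0.
  by rewrite cardF natrX => /eqP; rewrite expf_eq0 => /andP[].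
(* Frobenius is injective on E and sends theta x - 1 to theta (p x) - 1 = theta 0 - 1. *)
rewrite -subr_eq0 -(fmorph_eq0 (pFrobenius_aut pE)) rmorphB rmorph1 /=.
by rewrite pFrobenius_autE -characterMn mulrn_pchar // character0 subrr.
Qed.

End Characters.

Section ExponentialSum.
Variables (F : finFieldType) (E : fieldType).

Lemma sum_units_const (k : E) :
  \sum_(a : F | a != 0) k = (#|F|%:R - 1) * k.
Proof.
have : \sum_(a : F) k = #|F|%:R * k by rewrite sumr_const mulr_natl.
by rewrite (bigD1 0) //= mulrBl mul1r => <-; rewrite addrC addrK.
Qed.

Lemma sum_units_eq (c : F) :
  c != 0 -> \sum_(a : F | a != 0) (a == c)%:R = 1 :> E.
Proof.
move=> c0; rewrite (bigD1 c) //= eqxx big1 ?addr0 // => a /andP[_].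
by move/negPf->.
Qed.

Lemma card_slope_zeros :
  \sum_(a : F | a != 0) \sum_(b : F | b != 0)
    (1 + a + b - a * b * (a + b + a * b) == 0)%:R = 3 * #|F|%:R - 5 :> E.
Proof.
have N10 : -1 != 0 :> F by rewrite oppr_eq0 oner_eq0.
(* For a = -1 all q - 1 values of b count; otherwise only b = 1/a and b = -1 do. The coefficient q -
   3 is the excess (q - 1) - 2. *)
have inner (a : F) : a != 0 ->
  \sum_(b : F | b != 0) (1 + a + b - a * b * (a + b + a * b) == 0)%:R
    = 2 + (#|F|%:R - 3) * (a == -1)%:R :> E.
  move=> a0.
  have slopeE b : (1 + a + b - a * b * (a + b + a * b) == 0)
                  = [|| b == a^-1, a == -1 | b == -1].
    have -> : 1 + a + b - a * b * (a + b + a * b)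
              = a * (a^-1 - b) * ((a + 1) * (b + 1)) by field.
    by rewrite !mulf_eq0 (negPf a0) subr_eq0 !addr_eq0 (eq_sym a^-1) /=.
  under eq_bigr do rewrite slopeE.
  have [->|aN1] := eqVneq a (-1).
    by under eq_bigr do rewrite /= orbT; rewrite sum_units_const /= mulr1n; ring.
  have aVN1 : a^-1 != -1 by rewrite -invrN1 (inj_eq invr_inj).
  have -> : 2 + (#|F|%:R - 3) * false%:R
      = \sum_(b : F | b != 0) ((b == a^-1)%:R + (b == -1)%:R) :> E.
    by rewrite big_split /= !sum_units_eq ?invr_eq0 // mulr0n; ring.
  (* The two roots are distinct, so the indicator of the disjunction is the sum of the
     indicators. *)
  apply: eq_bigr => b _.
  by have [->|_] := eqVneq b a^-1; rewrite ?(negPf aVN1) /= ?add0r ?addr0.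
rewrite (eq_bigr _ inner) big_split /= -mulr_sumr sum_units_const.
by rewrite sum_units_eq //; ring.
Qed.

Lemma exp_sumE (theta : F -> E) :
    additive_character theta -> nontrivial_character theta ->
  exp_sum theta = 2 * #|F|%:R ^+ 2 - 3 * #|F|%:R - 1.
Proof.
move=> theta_char theta_nt.
pose slope (a b : F) := 1 + a + b - a * b * (a + b + a * b).
have -> : exp_sum theta = \sum_(t2 : F | t2 != 0) \sum_(a : F | a != 0)
            \sum_(b : F | b != 0) theta (t2 * slope a b).
  (* With t2 outermost, t1 and t3 can be rescaled by it. *)
  rewrite /exp_sum exchange_big /=; apply: eq_bigr => t2 t20.
  have unit_scale (G : F -> E) :
      \sum_(t | t != 0) G t = \sum_(a | a != 0) G (a * t2).
    rewrite (reindex_inj (mulIf t20)) /=.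
    by apply: eq_bigl => a; rewrite mulf_eq0 (negPf t20) orbF.
  rewrite unit_scale; apply: eq_bigr => a a0.
  rewrite unit_scale; apply: eq_bigr => b b0.
  by congr theta; rewrite /slope; field.
have -> : \sum_(t2 : F | t2 != 0) \sum_(a : F | a != 0)
            \sum_(b : F | b != 0) theta (t2 * slope a b)
        = \sum_(a : F | a != 0) \sum_(b : F | b != 0)
            ((slope a b == 0)%:R * #|F|%:R - 1).
  (* Now t2 moves innermost, where orthogonality applies. *)
  rewrite exchange_big; apply: eq_bigr => a _.
  rewrite exchange_big; apply: eq_bigr => b _.
  exact: sum_character_units.
under eq_bigr do rewrite sumrB -mulr_suml sum_units_const.
by rewrite sumrB -mulr_suml card_slope_zeros sum_units_const; ring.
Qed.

End ExponentialSum.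

Theorem theorem3p1 (p q l : nat) (p_prime : prime p)
    (q_power : exists k : nat, q = (p ^ k.+1)%N)
    (l_prime : prime l) (l_neq_p : l <> p)
    (Fq : finFieldType) (card_Fq : #|Fq| = q)
    (Qlbar : closedFieldType) (iota : {rmorphism padic l_prime -> Qlbar})
    (Qlbar_closure : is_algebraic_closure iota)
    (theta : Fq -> Qlbar) (theta_char : additive_character theta)
    (theta_nontrivial : nontrivial_character theta) :
  let L := exp_sum theta in
  #|twisted_cubic Fq|%:R =
    - 2%:R * q%:R ^+ 2 + 6%:R * q%:R - 1 + ((q%:R - 1) * L - 1) / q%:R
      :> Qlbar.
Proof.
move=> L; have [k qE] := q_power.
have cardF : #|Fq| = (p ^ k.+1)%N by rewrite card_Fq.
have q0 : #|Fq|%:R != 0 :> Qlbar.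
  exact: (character_card_neq0 _ _ _ theta_char theta_nontrivial _ _ p_prime cardF).
rewrite /L exp_sumE // card_twisted_cubic -natr1 -card_Fq.
(* The numerator (q - 1) L - 1 equals q (2 q^2 - 5 q + 2). *)
by field.
Qed.
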